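(* Let $\mathbb R^d=\mathbb R^{d_1}\times\cdots\times\mathbb R^{d_n}$, let the support of the uncertainty be the nonempty polyhedral set $\Xi:=\{\xi\in\mathbb R^d:\ C\xi\preceq f\}$, and assume that each set $\mathbb A_j:=\{\xi\in\mathbb R^d:\ A_j\xi\preceq b_j\}$, $j\in[m]$, has nonempty intersection with $\Xi$. Let $\mathbb A:=\cup_{j=1}^m\mathbb A_j$, let $Q=\sum_{l=1}^M\vartheta_l\delta_{\xi^l}$ be a discrete distribution with atoms $\xi^1,\ldots,\xi^M\in\Xi$ and masses $\vartheta_1,\ldots,\vartheta_M$, and let $\bm\varepsilon\succeq0$. Then the probability $$\sup_{P\in\mathcal T_1(Q,\bm\varepsilon)}P(\xi\in\mathbb A)$$ equals the optimal value of the convex program $$\begin{aligned}\inf_{\bm\lambda,\,s_l,\,\gamma_{lj},\,\theta_{lj}}\ &\langle\bm\lambda,\bm\varepsilon\rangle+\sum_{l=1}^M\vartheta_l s_l\\ \text{s.t.}\ \ &1+\langle\theta_{lj},b_j-A_j\xi^l\rangle+\langle\gamma_{lj},f-C\xi^l\rangle\le s_l,&& l\in[M],\ j\in[m],\\ &\|\mathrm{pr}_k^{\bm d}(A_j^\top\theta_{lj}+C^\top\gamma_{lj})\|_*\le\lambda_k,&& l\in[M],\ j\in[m],\ k\in[n],\\ &\gamma_{lj}\succeq0,\ \theta_{lj}\succeq0,\ s_l\ge0,&& l\in[M],\ j\in[m],\end{aligned}$$ with variables $\bm\lambda=(\lambda_1,\ldots,\lambda_n)\in\mathbb R^n$, $s_l\in\mathbb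 R$, and vectors $\gamma_{lj}$, $\theta_{lj}$ of the same dimensions as $f$ and $b_j$, respectively.
   Context: Notation: $[N]:=\{1,\ldots,N\}$; $x\succeq y$ (equivalently $y\preceq x$) means all components of $x-y$ are nonnegative; $\bm d:=(d_1,\ldots,d_n)$, $d=d_1+\cdots+d_n$; elements of $\mathbb R^d$ are written $\xi=(\xi_1,\ldots,\xi_n)$ with $\xi_k\in\mathbb R^{d_k}$, and $\mathrm{pr}_k^{\bm d}(\xi)=\xi_k$. Here $C,A_j$ are real matrices with $d$ columns and $f,b_j$ real vectors of compatible dimensions. Each $\mathbb R^{d_k}$ carries an (arbitrary) norm denoted $\|\cdot\|$ with dual norm $\|z\|_*:=\sup_{\|\xi\|\le1}\langle z,\xi\rangle$. With $\mathcal P(\cdot)$ denoting Borel probability measures, the multi-transport hyperrectangle for $p=1$ is $$\mathcal T_1(Q,\bm\varepsilon):=\Big\{\mathrm{pr}_{2\#}\pi:\ \pi\in\mathcal P(\Xi\times\Xi),\ \mathrm{pr}_{1\#}\pi=Q,\ \int_{\Xi\times\Xi}\|\zeta_k-\xi_k\|\,d\pi(\zeta,\xi)\le\varepsilon_k\ \text{for all }k\in[n]\Big\},$$ where $\mathrm{pr}_{1\#}\pi,\mathrm{pr}_{2\#}\pi$ are the first and second marginals of $\pi$. *)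

(* Defs.v *)
From HB Require Import structures.
From mathcomp Require Import all_boot all_order all_algebra.
From mathcomp Require Import all_classical all_reals all_analysis.

Set Implicit Arguments.
Unset Strict Implicit.
Unset Printing Implicit Defensive.

Import Order.TTheory GRing.Theory Num.Theory.
Import numFieldNormedType.Exports.

Local Open Scope classical_set_scope.
Local Open Scope ring_scope.

Definition dot (R : realType) (q : nat) (u v : 'cV[R]_q) : R :=
  \sum_(i < q) u i 0 * v i 0.

Definition preceq (R : realType) (q : nat) (x y : 'cV[R]_q) : Prop :=
  forall i, x i 0 <= y i 0.

Definition polyhedron (R : realType) (q D : nat)
    (E : 'M[R]_(q, D)) (g : 'cV[R]_q) : set 'cV[R]_D :=
  [set xi | preceq (E *m xi) g].

(* An arbitrary norm on R^q, given as a function: the norm that the library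
   puts on 'cV[R]_q is the sup norm, used below only for its topology. *)
Record is_norm (R : realType) (q : nat) (N : 'cV[R]_q -> R) : Prop := IsNorm {
  is_normD : forall x y, N (x + y) <= N x + N y ;
  is_normZ : forall (a : R) x, N (a *: x) = `|a| * N x ;
  is_norm_eq0 : forall x, N x = 0 -> x = 0 }.

(* Extended-real valued, so that no junk value of [sup] is involved; it is
   finite whenever N is a norm. *)
Definition dual_norm (R : realType) (q : nat) (N : 'cV[R]_q -> R)
    (z : 'cV[R]_q) : \bar R :=
  ereal_sup [set (dot z xi)%:E | xi in [set xi | N xi <= 1]].

(* R^d = R^{d_1} x ... x R^{d_n} as block column vectors; the projection pr_k
   onto the k-th factor is [fun xi => submxcol xi k]. *)
Notation blockvec R d := 'cV[R]_(\sum_k d k)%N.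

(* Absent from the library, which gives the product its two structures only
   separately. *)
HB.instance Definition _ (T U : ptopologicalType) := Pointed.on (T * U)%type.

Definition borel (T : ptopologicalType) : Type := g_sigma_algebraType (@open T).
HB.instance Definition _ (T : ptopologicalType) :=
  Measurable.copy (borel T) (g_sigma_algebraType (@open T)).

(* Borel probability measures on Xi x Xi are those Borel probability measures
   on the ambient space that give mass 1 to Xi x Xi.  Equalities of measures
   are asserted on measurable sets only, since the library does not constrain
   the value of a measure elsewhere. *)
Definition multi_transport_1 (R : realType) (n : nat) (d : 'I_n -> nat)
    (N : forall k, 'cV[R]_(d k) -> R) (Xi : set (blockvec R d))
    (Q : probability (borel (blockvec R d)) R) (eps : 'cV[R]_n) :
    set (probability (borel (blockvec R d)) R) :=
  let E := borel (blockvec R d) in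
  let EE := borel (blockvec R d * blockvec R d)%type in
  [set P : probability E R | exists pi : probability EE R,
    [/\ pi (Xi `*` Xi) = 1%E,
        forall B : set E, measurable B ->
          pushforward pi (fst : EE -> E) B = Q B,
        forall k, (\int[pi]_z (N k (submxcol z.1 k - submxcol z.2 k))%:E
                     <= (eps k 0)%:E)%E
      & forall B : set E, measurable B ->
          pushforward pi (snd : EE -> E) B = P B] ].

(* Main.v *)
From HB Require Import structures.
Require Import Defs.
From mathcomp Require Import all_boot all_order all_algebra.
From mathcomp Require Import all_classical all_reals all_analysis.
From mathcomp Require Import measurable_realfun.
From mathcomp Require Import ring lra.

(* Splitting the mass of each atom [xi l] over the sets [A j] reduces the primal
   to a finite-dimensional problem in masses [w l j] and mass-weighted
   displacements [y l j], with constraints of perspective type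
   [A j *m y <= w *: (b j - A j *m xi l)].  This is maximization of a linear
   function over a polyhedral cone under finitely many norm constraints, for
   which [y = 0] is a Slater point.  Multipliers for the norm constraints come
   from a separation argument; the problem then splits over [(l, j)], and each
   piece is dualized by replacing the norms by a linear minorant (separation
   again) followed by Farkas' lemma for the polyhedral constraints.  The converse
   inequality is integration of the pointwise dual inequality against an
   arbitrary coupling. *)

Set Implicit Arguments.
Unset Strict Implicit.

Import Order.TTheory GRing.Theory Num.Theory.
Import numFieldNormedType.Exports.

Local Open Scope classical_set_scope.
Local Open Scope ring_scope.

(** * Separation, Farkas' lemma and Lagrange multipliers *)

Lemma dotC (R : realType) (p : nat) (u v : 'cV[R]_p) : dot u v = dot v u.
Proof. by apply: eq_bigr => i _; rewrite mulrC. Qed.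

Lemma dotDr (R : realType) (p : nat) (u v w : 'cV[R]_p) :
  dot u (v + w) = dot u v + dot u w.
Proof. by rewrite /dot -big_split; apply: eq_bigr => i _; rewrite mxE mulrDr. Qed.

Lemma dotZr (R : realType) (p : nat) (c : R) (u v : 'cV[R]_p) :
  dot u (c *: v) = c * dot u v.
Proof. by rewrite /dot mulr_sumr; apply: eq_bigr => i _; rewrite mxE mulrCA. Qed.

Lemma dot0r (R : realType) (p : nat) (u : 'cV[R]_p) : dot u 0 = 0.
Proof. by rewrite /dot big1 // => i _; rewrite mxE mulr0. Qed.

Lemma dotNr (R : realType) (p : nat) (u v : 'cV[R]_p) : dot u (- v) = - dot u v.
Proof. by rewrite -scaleN1r dotZr mulN1r. Qed.

Lemma dotBr (R : realType) (p : nat) (u v w : 'cV[R]_p) :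
  dot u (v - w) = dot u v - dot u w.
Proof. by rewrite dotDr dotNr. Qed.

Lemma dotDl (R : realType) (p : nat) (u v w : 'cV[R]_p) :
  dot (u + v) w = dot u w + dot v w.
Proof. by rewrite dotC dotDr !(dotC w). Qed.

Lemma dotZl (R : realType) (p : nat) (c : R) (u v : 'cV[R]_p) :
  dot (c *: u) v = c * dot u v.
Proof. by rewrite dotC dotZr dotC. Qed.

Lemma dot_delta (R : realType) (p : nat) (u : 'cV[R]_p) (i : 'I_p) :
  dot u (delta_mx i 0) = u i 0.
Proof.
rewrite /dot (bigD1 i) //= big1 => [|k ki]; first by rewrite mxE !eqxx mulr1 addr0.
by rewrite mxE (negbTE ki) mulr0.
Qed.

Lemma dot_mulmx (R : realType) (p q : nat) (G : 'M[R]_(p, q)) u v :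
  dot (G^T *m u) v = dot u (G *m v).
Proof.
rewrite /dot.
under eq_bigr do rewrite mxE mulr_suml.
under [in RHS]eq_bigr do rewrite mxE mulr_sumr.
rewrite exchange_big; apply: eq_bigr => i _; apply: eq_bigr => j _.
by rewrite mxE; ring.
Qed.

Lemma dot_ge0 (R : realType) (p : nat) (u v : 'cV[R]_p) :
  preceq 0 u -> preceq 0 v -> 0 <= dot u v.
Proof.
move=> u0 v0; apply: sumr_ge0 => i _.
by apply: mulr_ge0; [have := u0 i|have := v0 i]; rewrite mxE.
Qed.

(** Hahn-Banach extension, one coordinate at a time. The functional on vectors supported on the
    first [k] coordinates is extended by a slope lying between all slopes forced from the two sides
    of the next hyperplane; points of [S] over both half-axes keep that slope finite. *)
Lemma separation (R : realType) (n : nat) (S : 'cV[R]_n -> R -> Prop) :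
  (forall t a t' a' c, S t a -> S t' a' -> 0 <= c -> c <= 1 ->
     S (c *: t + (1 - c) *: t') (c * a + (1 - c) * a')) ->
  (forall a, S 0 a -> a <= 0) ->
  (forall i, exists e a, 0 < e /\ S (e *: delta_mx i 0) a) ->
  (forall i, exists e a, 0 < e /\ S (- e *: delta_mx i 0) a) ->
  exists eta : 'cV[R]_n, forall t a, S t a -> a <= dot eta t.
Proof.
move=> Scvx S0 Spos Sneg.
suff : forall k, exists eta : 'cV[R]_n, forall t a, S t a ->
    (forall i : 'I_n, (k <= i)%N -> t i 0 = 0) -> a <= dot eta t.
  move=> /(_ n)[eta Heta]; exists eta => t a /Heta; apply => i.
  by rewrite leqNgt ltn_ord.
elim=> [|k [eta IH]].
  exists 0 => t a Sta t0; rewrite dotC dot0r; apply: S0.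
  by rewrite (_ : 0 = t) //; apply/colP => i; rewrite t0 // mxE.
have [nk|kn] := leqP n k.
  exists eta => t a Sta _; apply: IH => // i ki.
  by have := leq_trans nk ki; rewrite leqNgt ltn_ord.
pose i0 := Ordinal kn.
pose slice (t : 'cV[R]_n) a := S t a /\ forall i : 'I_n, (k < i)%N -> t i 0 = 0.
have slopes t a t' a' : slice t a -> slice t' a' -> 0 < t i0 0 -> t' i0 0 < 0 ->
    (a - dot eta t) / t i0 0 <= (a' - dot eta t') / t' i0 0.
  move=> [Sta tz] [Sta' tz'] tpos tneg.
  have D0 : 0 < t i0 0 - t' i0 0 by lra.
  (* The weight for which coordinate [i0] of [c *: t + (1 - c) *: t'] vanishes, so that [IH] applies
     to the combination. *)
  pose c := - t' i0 0 / (t i0 0 - t' i0 0).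
  have c1 : 1 - c = t i0 0 / (t i0 0 - t' i0 0) by rewrite /c; field; lra.
  have c_ge0 : 0 <= c by rewrite divr_ge0 //; lra.
  have c_le1 : c <= 1 by rewrite ler_pdivrMr //; lra.
  have := Scvx _ _ _ _ _ Sta Sta' c_ge0 c_le1.
  move=> /IH; rewrite dotDr !dotZr => H.
  have {H} : c * (a - dot eta t) + (1 - c) * (a' - dot eta t') <= 0.
    suff : c * a + (1 - c) * a' <= c * dot eta t + (1 - c) * dot eta t' by lra.
    apply: H => i; rewrite leq_eqVlt => /orP[/eqP ki|ki].
      rewrite (_ : i = i0); last exact/val_inj.
      by rewrite !mxE c1 /c; field; lra.
    by rewrite !mxE tz // tz' // !mulr0 addr0.
  rewrite c1 /c !(mulrAC _ (_^-1)) -mulrDl pmulr_lle0 ?invr_gt0 // => H.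
  rewrite ler_ndivlMr // mulrAC ler_pdivlMr //; lra.
have slice_delta e a : S (e *: delta_mx i0 0) a -> slice (e *: delta_mx i0 0) a.
  split=> // i ki; rewrite !mxE (_ : (i == i0) = false) ?mulr0 //.
  by apply/negbTE; rewrite -val_eqE /= neq_ltn ki orbT.
pose sl := [set x | exists t a, [/\ slice t a, 0 < t i0 0
                                 & x = (a - dot eta t) / t i0 0]].
(* [Spos] makes the set of slopes nonempty; any slope supplied by [Sneg] bounds it. *)
have sl_sup : has_sup sl.
  split.
    have [e [a [e0 /slice_delta Sa]]] := Spos i0.
    by eexists; exists (e *: delta_mx i0 0), a; split; first exact: Sa;
       rewrite // !mxE !eqxx mulr1.
  have [e [a [e0 /slice_delta Sa]]] := Sneg i0.
  exists ((a - dot eta (- e *: delta_mx i0 0)) / (- e *: delta_mx i0 0 : 'cV[R]_n) i0 0).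
  move=> x [t [a' [Sta tpos ->]]]; apply: slopes => //.
  by rewrite !mxE !eqxx mulr1 oppr_lt0.
exists (eta + sup sl *: delta_mx i0 0) => t a Sta tz.
rewrite dotDl dotZl (dotC (delta_mx _ _)) dot_delta.
have slta : slice t a by split.
have [tpos|tneg|t0] := ltrgt0P (t i0 0).
- suff : (a - dot eta t) / t i0 0 <= sup sl by rewrite ler_pdivrMr //; lra.
  by apply: ub_le_sup; [case: sl_sup|exists t, a].
- suff : sup sl <= (a - dot eta t) / t i0 0 by rewrite ler_ndivlMr //; lra.
  apply: ge_sup; first by case: sl_sup.
  by move=> x [t' [a' [Sta' t'pos ->]]]; apply: slopes.
- rewrite t0 mulr0 addr0; apply: IH => // i; rewrite leq_eqVlt => /orP[/eqP ki|/tz //].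
  by rewrite (_ : i = i0) //; exact/val_inj.
Qed.

(* Bartl's induction: if dropping the constraint [a i] breaks the implication
   at a point [v0], project along [v0] onto the kernel of [a i]. *)
Lemma farkas (R : realFieldType) (V : lmodType R) (I : eqType) (s : seq I)
    (a : I -> V -> R) (z : V -> R) :
  uniq s -> (forall i, scalar (a i)) -> scalar z ->
  (forall v, (forall i, i \in s -> 0 <= a i v) -> 0 <= z v) ->
  exists2 mu : I -> R, (forall i, 0 <= mu i)
    & forall v, z v = \sum_(i <- s) mu i * a i v.
Proof.
elim: s a z => [|i s IH] a z /= us la lz Hz.
  exists (fun=> 0) => // v; rewrite big_nil; apply/eqP; rewrite eq_le Hz // andbT.
  have zN : z (- v) = - z v.
    have z0 : z 0 = 0 by have := lz 1 0 0; rewrite scale1r addr0 mul1r; lra.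
    by rewrite -[- v]addr0 -scaleN1r lz z0 addr0 mulN1r.
  by rewrite -oppr_ge0 -zN Hz.
case/andP: us => is_ us.
have [Hz'|] := pselect (forall v, (forall i, i \in s -> 0 <= a i v) -> 0 <= z v).
  have [mu mu0 zE] := IH a z us la lz Hz'.
  exists (fun j => if j == i then 0 else mu j) => [j|v]; first by case: ifP.
  rewrite big_cons eqxx mul0r add0r zE; apply: eq_big_seq => j js.
  by case: eqP => // ji; rewrite -ji js in is_.
move=> /existsNP[v0 /not_implyP[av0 /negP]]; rewrite -ltNge => zv0.
have aiv0 : a i v0 < 0.
  rewrite ltNge; apply/negP => aiv0.
  have : 0 <= z v0 by apply: Hz => j; rewrite inE => /orP[/eqP ->|/av0].
  by rewrite leNgt zv0.
pose c v := - (a i v / a i v0).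
have cl : scalar c by move=> k u v; rewrite /c la; field; lra.
have proj v : a i (c v *: v0 + v) = 0 by rewrite la /c; field; lra.
have lproj (h : V -> R) : scalar h -> scalar (fun v => h (c v *: v0 + v)).
  by move=> hl k u v; rewrite !hl cl; ring.
have [|//|//|mu mu0 zE] :=
    IH (fun j v => a j (c v *: v0 + v)) (fun v => z (c v *: v0 + v)) us.
- by move=> j; apply: lproj.
- exact: lproj.
- move=> v Hv; apply: Hz => j; rewrite inE => /orP[/eqP ->|/Hv //].
  by rewrite proj.
(* Expanding the identity for the projected vector leaves a multiple of [c v], hence of [a i v]; its
   coefficient is the new multiplier. It is nonnegative because [z v0 < 0], [a i v0 < 0] and the
   other [a k v0] are nonnegative. *)
exists (fun j => if j == i then (\sum_(k <- s) mu k * a k v0 - z v0) / - a i v0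
                 else mu j) => [j|v].
  case: ifP => // _; rewrite divr_ge0 ?subr_ge0 ?oppr_ge0 ?(ltW aiv0) //.
  rewrite (le_trans (ltW zv0)) // big_seq sumr_ge0 // => k ks.
  by rewrite mulr_ge0 // av0.
rewrite big_cons eqxx.
have -> : \sum_(j <- s) (if j == i then (\sum_(k <- s) mu k * a k v0 - z v0) / - a i v0
   else mu j) * a j v = \sum_(j <- s) mu j * a j v.
  by apply: eq_big_seq => j js; case: eqP => // ji; rewrite -ji js in is_.
have := zE v; rewrite lz; under eq_bigr do rewrite la mulrDr.
rewrite big_split /=.
have -> : \sum_(j <- s) mu j * (c v * a j v0) = c v * \sum_(j <- s) mu j * a j v0.
  by rewrite mulr_sumr; apply: eq_bigr => j _; ring.
move=> H; have -> : z v = c v * (\sum_(j <- s) mu j * a j v0 - z v0)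
   + \sum_(j <- s) mu j * a j v by lra.
by rewrite /c; congr (_ + _); field; lra.
Qed.

(** Separation applied to the perturbation set of pairs [(t, a)] for which some [x] in [X] has
    [g x <= t] and [a <= f x - p]. The Slater point [x0] lies strictly inside every constraint,
    which provides points over the negative half-axes. *)
Lemma lagrange_multipliers (R : realType) (V : lmodType R) (n : nat)
    (X : set V) (f : V -> R) (g : 'I_n -> V -> R) (x0 : V) (p : R) :
  (forall x y c, X x -> X y -> 0 <= c -> c <= 1 -> X (c *: x + (1 - c) *: y)) ->
  (forall x y c, 0 <= c -> c <= 1 ->
     c * f x + (1 - c) * f y <= f (c *: x + (1 - c) *: y)) ->
  (forall k x y c, 0 <= c -> c <= 1 ->
     g k (c *: x + (1 - c) *: y) <= c * g k x + (1 - c) * g k y) ->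
  X x0 -> (forall k, g k x0 < 0) ->
  (forall x, X x -> (forall k, g k x <= 0) -> f x <= p) ->
  exists2 lambda : 'I_n -> R, (forall k, 0 <= lambda k)
    & forall x, X x -> f x <= p + \sum_k lambda k * g k x.
Proof.
move=> Xcvx fcvx gcvx Xx0 gx0 fp.
pose S (t : 'cV[R]_n) (a : R) :=
  exists x, [/\ X x, forall k, g k x <= t k 0 & a <= f x - p].
have Sx0 (i : 'I_n) (e : R) : g i x0 <= e -> S (e *: delta_mx i 0) (f x0 - p).
  move=> ge; exists x0; split=> // k; rewrite !mxE eqxx andbT.
  by case: eqP => [->|_]; rewrite ?mulr1 // mulr0 ltW.
have [||i|i|eta Heta] := @separation R n S.
- move=> t a t' a' c [x [Xx gx ax]] [y [Xy gy ay]] c0 c1.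
  exists (c *: x + (1 - c) *: y); split; first exact: Xcvx.
    move=> k; rewrite !mxE (le_trans (gcvx _ _ _ _ c0 c1)) //.
    by rewrite lerD // ler_wpM2l // subr_ge0.
  have := fcvx x y c c0 c1.
  have := ler_wpM2l c0 ax; have := ler_wpM2l (_ : 0 <= 1 - c) ay.
  by rewrite subr_ge0 => /(_ c1); lra.
- move=> a [x [Xx gx ax]]; rewrite (le_trans ax) // subr_le0 fp // => k.
  by have := gx k; rewrite mxE.
- by exists 1, (f x0 - p); split=> //; apply: Sx0; have := gx0 i; lra.
- exists (- g i x0), (f x0 - p); split; first by rewrite oppr_gt0.
  by apply: Sx0; rewrite opprK.
exists (fun k => eta k 0) => [k|x Xx]; last first.
  have : S (\col_k g k x) (f x - p) by exists x; split=> // k; rewrite mxE.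
  move=> /Heta; suff -> : dot eta (\col_k g k x) = \sum_k eta k 0 * g k x by lra.
  by apply: eq_bigr => k _; rewrite mxE.
rewrite leNgt; apply/negP => etak.
(* With [eta k 0 < 0], relaxing constraint [k] far enough brings the separating functional down to
   [- e], below the value [f x0 - p] still reached there. *)
pose e := `|f x0 - p| + 1.
have e0 : 0 < e by rewrite ltr_wpDl.
have /Heta : S ((e / - eta k 0) *: delta_mx k 0) (f x0 - p).
  apply: Sx0; by rewrite (le_trans (ltW (gx0 k))) // divr_ge0 ?oppr_ge0 ?(ltW e0) ?(ltW etak).
rewrite dotZr dot_delta (_ : _ * _ = - e); last by field; lra.
by have := ler_norm (- (f x0 - p)); rewrite normrN /e; lra.
Qed.

(** Decoupling the argument [u] of [P] from [E *m y] and separating in the difference [u - E *m y]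
    yields a linear minorant [- eta] of [P] that preserves the bound on the cone. What remains is a
    linear inequality over a polyhedral cone, which is Farkas' lemma. *)
Lemma conic_multipliers (R : realType) (p D : nat) (G : 'M[R]_(p, D))
    (h : 'cV[R]_p) (E : 'M[R]_D) (P : 'cV[R]_D -> R) (s : R) :
  P 0 = 0 ->
  (forall x y c, 0 <= c -> c <= 1 ->
     P (c *: x + (1 - c) *: y) <= c * P x + (1 - c) * P y) ->
  (forall w y, 0 <= w -> preceq (G *m (E *m y)) (w *: h) ->
     w * (1 - s) <= P (E *m y)) ->
  exists mu : 'cV[R]_p, [/\ preceq 0 mu, 1 + dot mu h <= s
    & forall y, - P (E *m y) <= dot (G^T *m mu) (E *m y)].
Proof.
move=> P0 Pcvx GP.
pose S (t : 'cV[R]_D) (a : R) := exists w y u, [/\ 0 <= w,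
  preceq (G *m (E *m y)) (w *: h), t = u - E *m y & a <= w * (1 - s) - P u].
(* The zero of the cone leaves [u] free: every direction is reached, and separation then gives
   [- P u <= dot eta u]. *)
have S00 u : S u (- P u).
  exists 0, 0, u; split=> //; last by rewrite mul0r sub0r.
    by rewrite !mulmx0 scale0r => i.
  by rewrite mulmx0 subr0.
have [||i|i|eta Heta] := @separation R D S.
- move=> t a t' a' c [w [y [u [w0 Gy -> au]]]] [w' [y' [u' [w0' Gy' -> au']]]] c0 c1.
  have c1' : 0 <= 1 - c by lra.
  exists (c * w + (1 - c) * w'), (c *: y + (1 - c) *: y'), (c *: u + (1 - c) *: u').
  split.
  + by rewrite addr_ge0 // mulr_ge0.
  + move=> i; rewrite !mulmxDr -!scalemxAr !mxE.
    have := ler_wpM2l c0 (Gy i); have := ler_wpM2l c1' (Gy' i).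
    by rewrite !mxE; lra.
  + by rewrite mulmxDr -!scalemxAr !scalerBr opprD !addrA; congr (_ - _); rewrite addrAC.
  + have := Pcvx u u' c c0 c1.
    by have := ler_wpM2l c0 au; have := ler_wpM2l c1' au'; lra.
- move=> a [w [y [u [w0 Gy /eqP]]]]; rewrite eq_sym subr_eq0 => /eqP -> au.
  by rewrite (le_trans au) // subr_le0 GP.
- by exists 1, (- P (1 *: delta_mx i 0)); split.
- by exists 1, (- P (-1 *: delta_mx i 0)); split.
(* The left indices are the rows of [G], the right one is the sign constraint on [w]. *)
pose a (i : 'I_p + 'I_1) (v : R^o * 'cV[R]_D) : R :=
  if i is inl i then v.1 * h i 0 - (G *m (E *m v.2)) i 0 else v.1.
pose z (v : R^o * 'cV[R]_D) : R := - (v.1 * (1 - s)) - dot eta (E *m v.2).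
have la i : scalar (a i).
  case: i => [i|] k u v //=; rewrite !mulmxDr -!scalemxAr !mxE /GRing.scale /=.
  by ring.
have lz : scalar z.
  move=> k u v; rewrite /z /= !mulmxDr -!scalemxAr dotDr dotZr /GRing.scale /=.
  by ring.
have [v av|mu mu0 zE] := farkas (index_enum_uniq _) la lz.
  have Sv : S (0 - E *m v.2) (v.1 * (1 - s)).
    exists v.1, v.2, 0; split=> //; last by rewrite P0 subr0.
      exact: (av (inr 0) (mem_index_enum _)).
    by move=> i; have := av (inl i) (mem_index_enum _); rewrite /= subr_ge0 [X in _ -> _ <= X]mxE.
  by have := Heta _ _ Sv; rewrite sub0r dotNr /z; lra.
exists (\col_i mu (inl i)); split.
- by move=> i; rewrite !mxE.
(* At [(1, 0)] the identity reads [s - 1 = dot mu h] plus the multiplier of [0 <= w]; discarding the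
   latter gives the inequality. At [(0, y)] it identifies [eta] with [G^T *m mu] on the range of
   [E]. *)
- have := zE (1, 0); rewrite /z /= mulmx0 dot0r big_sumType big_ord1 /=.
  rewrite (_ : \sum_i _ = dot (\col_i mu (inl i)) h).
    by have := mu0 (inr 0); lra.
  by apply: eq_bigr => i _; rewrite !mulmx0 !mxE; ring.
- move=> y; have := zE (0, y); rewrite /z /= big_sumType big_ord1 /= !mul0r mulr0.
  rewrite (_ : \sum_i _ = - dot (\col_i mu (inl i)) (G *m (E *m y))); last first.
    rewrite -dotNr; apply: eq_bigr => i _; rewrite !mxE; ring.
  by rewrite dot_mulmx; have := Heta _ _ (S00 (E *m y)); lra.
Qed.

(** * Norms on column vectors *)

Lemma is_norm0 (R : realType) (p : nat) (N : 'cV[R]_p -> R) : is_norm N -> N 0 = 0.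
Proof. by move=> nN; rewrite -(scale0r 0) (is_normZ nN) normr0 mul0r. Qed.

Lemma is_normN (R : realType) (p : nat) (N : 'cV[R]_p -> R) x :
  is_norm N -> N (- x) = N x.
Proof. by move=> nN; rewrite -scaleN1r (is_normZ nN) normrN1 mul1r. Qed.

Lemma is_norm_ge0 (R : realType) (p : nat) (N : 'cV[R]_p -> R) x :
  is_norm N -> 0 <= N x.
Proof.
move=> nN; have := is_normD nN x (- x).
by rewrite subrr (is_norm0 nN) (is_normN _ nN); lra.
Qed.

Lemma is_norm_convex (R : realType) (p : nat) (N : 'cV[R]_p -> R) x y c :
  is_norm N -> 0 <= c -> c <= 1 ->
  N (c *: x + (1 - c) *: y) <= c * N x + (1 - c) * N y.
Proof.
move=> nN c0 c1; rewrite (le_trans (is_normD nN _ _)) // !(is_normZ nN).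
by rewrite !ger0_norm // subr_ge0.
Qed.

Lemma mx_coord_le_norm (R : realType) (m p : nat) (x : 'M[R]_(m, p)) i j :
  `|x i j| <= `|x|.
Proof.
by rewrite [leRHS]/Num.norm /= mx_normrE (le_bigmax _ (fun ij => `|x ij.1 ij.2|) (i, j)).
Qed.

Lemma mx_norm_le (R : realType) (m p : nat) (x : 'M[R]_(m, p)) c :
  0 <= c -> (forall i j, `|x i j| <= c) -> `|x| <= c.
Proof.
move=> c0 xc; rewrite [leLHS]/Num.norm /= mx_normrE.
by apply/bigmax_leP; split=> // -[i j] _; exact: xc.
Qed.

Lemma is_norm_le_mx_norm (R : realType) (p : nat) (N : 'cV[R]_p -> R) :
  is_norm N -> exists2 B, 0 < B & forall x, N x <= B * `|x|.
Proof.
move=> nN; pose B := \sum_i N (delta_mx i 0).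
have B0 : 0 <= B by apply: sumr_ge0 => i _; exact: is_norm_ge0.
exists (B + 1) => [|x]; first lra.
have xE : x = \sum_i x i 0 *: delta_mx i 0.
  by rewrite [LHS]matrix_sum_delta; apply: eq_bigr => i _; rewrite big_ord1.
have : N x <= \sum_i `|x i 0| * N (delta_mx i 0).
  rewrite {1}xE; elim/big_ind2: _ => [|a a' b b' ha hb|i _].
  - by rewrite (is_norm0 nN).
  - by rewrite (le_trans (is_normD nN _ _)) // lerD.
  - by rewrite (is_normZ nN).
move=> /le_trans; apply; rewrite mulrDl mul1r mulr_suml.
rewrite ler_wpDr // ler_sum // => i _.
by rewrite mulrC ler_wpM2l ?mx_coord_le_norm // is_norm_ge0.
Qed.

Lemma is_norm_continuous (R : realType) (p : nat) (N : 'cV[R]_p -> R) :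
  is_norm N -> continuous N.
Proof.
move=> nN x; have [B B0 NB] := is_norm_le_mx_norm nN.
apply/(@cvgrPdist_le _ _ _ (nbhs x)) => e e0; near=> y.
have : `|N x - N y| <= N (x - y).
  have H1 := is_normD nN (x - y) y; have H2 := is_normD nN (y - x) x.
  have H3 := is_normN (x - y) nN.
  rewrite !subrK in H1 H2; rewrite opprB in H3.
  by rewrite ler_norml; apply/andP; split; lra.
move=> /le_trans; apply; rewrite (le_trans (NB _)) // mulrC -ler_pdivlMr //.
near: y; apply: (@cvgr_dist_le _ _ _ _ _ id x) => //.
by rewrite divr_gt0.
Unshelve. all: by end_near. Qed.

(* Equivalence of norms: [N] attains a positive minimum on the unit sphere. *)
Lemma mx_norm_le_is_norm (R : realType) (p : nat) (N : 'cV[R]_p -> R) :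
  is_norm N -> exists2 L, 0 <= L & forall x, `|x| <= L * N x.
Proof.
move=> nN; pose S := [set v : 'rV[R]_p | `|v| = 1].
have NT0 (x : 'cV[R]_p) : x != 0 -> 0 < N x.
  by move=> x0; rewrite lt_def is_norm_ge0 // andbT;
     apply: contra_neq x0 => /(is_norm_eq0 nN).
have normT (x : 'cV[R]_p) : `|x^T| = `|x|.
  apply/eqP; rewrite eq_le; apply/andP; split.
    by apply: mx_norm_le => // i j; rewrite mxE mx_coord_le_norm.
  by apply: mx_norm_le => // i j; rewrite -[x]trmxK mxE trmxK mx_coord_le_norm.
(* An empty sphere occurs in dimension zero; all norms then vanish and [L = 0] serves. *)
have [S0|/set0P/negP/negPn/eqP S0] := pselect (S !=set0); last first.
  exists 0 => // x; rewrite mul0r; apply/negP => /negP; rewrite -ltNge => x0.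
  have : S (`|x|^-1 *: x^T).
    by rewrite /S /= normrZ normfV normr_id normT mulVf // gt_eqF.
  by rewrite S0.
have cN : continuous (fun v : 'rV[R]_p => N v^T).
  move=> v; apply: continuous_comp; last exact: is_norm_continuous.
  move=> A [P PA sub]; exists (fun i j => P j i) => // => [i j|w Pw].
    by have := PA j i; rewrite mxE.
  by apply: sub => i j; rewrite mxE; exact: Pw.
have cS : compact S.
  apply: bounded_closed_compact.
    by exists 1; split => // M M1 v /= ->; exact: ltW.
  have -> : S = (fun v : 'rV[R]_p => `|v|) @^-1` [set 1] by [].
  apply: closed_comp; last exact: closed_eq.
  by move=> v _; exact: norm_continuous.
have [c /set_mem cS1 cmin] := EVT_min_rV S0 cS (continuous_subspaceT cN).
have c0 : 0 < N c^T.
  by apply: NT0; rewrite -normr_gt0 -normT trmxK cS1.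
exists (N c^T)^-1 => [|x]; first by rewrite invr_ge0 ltW.
have [->|x0] := eqVneq x 0; first by rewrite normr0 (is_norm0 nN) mulr0.
have nx : 0 < `|x| by rewrite normr_gt0.
have Sx : S (`|x|^-1 *: x^T).
  by rewrite /S /= normrZ normfV normr_id normT mulVf // gt_eqF.
have := cmin _ (mem_set Sx).
rewrite linearZ /= trmxK (is_normZ nN) normfV normr_id.
rewrite mulrC ler_pdivlMr // => Hc.
by rewrite mulrC ler_pdivlMr // mulrC.
Qed.

(** Finiteness of the dual norm, by equivalence with the sup norm. It supplies the dual variables of
    the blocks with zero transport budget. *)
Lemma dot_le_is_norm (R : realType) (p : nat) (N : 'cV[R]_p -> R) (z : 'cV[R]_p) :
  is_norm N -> exists2 L, 0 <= L & forall x, dot z x <= L * N x.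
Proof.
move=> /mx_norm_le_is_norm [L L0 HL].
have z0 : 0 <= \sum_i `|z i 0| by exact: sumr_ge0.
exists ((\sum_i `|z i 0|) * L) => [|x]; first exact: mulr_ge0.
rewrite -mulrA (le_trans _ (ler_wpM2l z0 (HL x))) // mulr_suml ler_sum // => i _.
by rewrite (le_trans (ler_norm _)) // normrM ler_wpM2l // mx_coord_le_norm.
Qed.

Lemma dot_le_dual_norm (R : realType) (p : nat) (N : 'cV[R]_p -> R) z L x :
  is_norm N -> (dual_norm N z <= L%:E)%E -> dot z x <= L * N x.
Proof.
move=> nN zL; have {}zL y : N y <= 1 -> dot z y <= L.
  move=> y1; rewrite -lee_fin (le_trans _ zL) //.
  by apply: ereal_sup_ubound; exists y.
have [/(is_norm_eq0 nN) ->|Nx0] := eqVneq (N x) 0.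
  by rewrite dot0r (is_norm0 nN) mulr0.
have Nx : 0 < N x by rewrite lt_def Nx0 is_norm_ge0.
have := zL ((N x)^-1 *: x); rewrite (is_normZ nN) normfV ger0_norm; last exact: ltW.
by rewrite mulVf // lexx dotZr mulrC ler_pdivrMr //; apply.
Qed.

(** Zero lies in the unit ball. In the dual program [lambda] has no sign constraint of its own; this
    is where its sign comes from. *)
Lemma dual_norm_le_ge0 (R : realType) (p : nat) (N : 'cV[R]_p -> R) z L :
  is_norm N -> (dual_norm N z <= L%:E)%E -> 0 <= L.
Proof.
move=> nN; rewrite -lee_fin; apply: le_trans.
by apply: ereal_sup_ubound; exists 0; rewrite /= ?(is_norm0 nN) // dot0r.
Qed.

Lemma dual_norm_le (R : realType) (p : nat) (N : 'cV[R]_p -> R) z L :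
  0 <= L -> (forall x, dot z x <= L * N x) -> (dual_norm N z <= L%:E)%E.
Proof.
move=> L0 zL; apply: ge_ereal_sup => _ [x /= Nx <-].
by rewrite lee_fin (le_trans (zL x)) // ler_piMr.
Qed.

(** * Borel measurability and discrete probabilities *)

Lemma continuous_borel_measurable (T U : ptopologicalType) (f : T -> U) :
  continuous f -> measurable_fun [set: borel T] (f : borel T -> borel U).
Proof.
move=> /continuousP cf.
apply: (@measurability _ _ (borel T) (borel U) _ f (@open U)) => //.
move=> _ [A oA <-]; rewrite setTI; apply: sub_sigma_algebra; exact: cf.
Qed.

(** The codomain carries the measurable structure of the reals rather than [borel R], so the
    generators are open intervals here. *)
Lemma continuous_borel_measurableR (T : ptopologicalType) (R : realType) (f : T -> R) :
  continuous f -> measurable_fun [set: borel T] (f : borel T -> R).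
Proof.
move=> /continuousP cf.
apply: (@measurability _ _ (borel T) R _ f _ (RGenOpens.measurableE R)).
move=> _ [_ [a [b ->] <-]]; rewrite setTI; apply: sub_sigma_algebra.
exact/cf/interval_open.
Qed.

Lemma closed_borel_measurable (T : ptopologicalType) (A : set (borel T)) :
  closed (A : set T) -> measurable A.
Proof.
move=> /closed_openC oA; rewrite -(setCK A); apply: measurableC.
exact: sub_sigma_algebra.
Qed.

Lemma measurable_borel_fst (T : ptopologicalType) :
  measurable_fun [set: borel (T * T)%type] (fst : borel (T * T)%type -> borel T).
Proof. by apply: (@continuous_borel_measurable (T * T)%type) => x; exact: cvg_fst. Qed.

Lemma measurable_borel_snd (T : ptopologicalType) :
  measurable_fun [set: borel (T * T)%type] (snd : borel (T * T)%type -> borel T).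
Proof. by apply: (@continuous_borel_measurable (T * T)%type) => x; exact: cvg_snd. Qed.

Lemma sum_continuous (R : realType) (T : topologicalType) (I : Type) (s : seq I)
    (F : I -> T -> R) :
  (forall i, continuous (F i)) -> continuous (fun x => \sum_(i <- s) F i x).
Proof.
move=> cF; elim: s => [|i s IH].
  under eq_fun do rewrite big_nil.
  by move=> x; exact: cvg_cst.
under eq_fun do rewrite big_cons.
by move=> x; apply: cvgD; [exact: cF|exact: IH].
Qed.

Lemma closed_polyhedron (R : realType) (p D : nat) (E : 'M[R]_(p, D)) g :
  closed (polyhedron E g).
Proof.
have -> : polyhedron E g =
    \bigcap_(i in [set: 'I_p]) (fun x => (E *m x) i 0) @^-1` [set y | y <= g i 0].
  by apply/seteqP; split=> [x Hx i _|x Hx i]; [exact: Hx|exact: (Hx i)].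
apply: closed_bigI => i _; apply: closed_comp; last exact: closed_le.
move=> x _; under [X in continuous_at _ X]eq_fun do rewrite mxE.
apply: sum_continuous => j y; apply: (@continuousM _ _ (fun=> E i j) (fun y : 'cV[R]_D => y j 0)).
  exact: cst_continuous.
exact: coord_continuous.
Qed.

Lemma measurable_norm_diff (R : realType) (n : nat) (d : 'I_n -> nat)
    (N : forall k, 'cV[R]_(d k) -> R) (k : 'I_n) :
  is_norm (N k) ->
  measurable_fun [set: borel (blockvec R d * blockvec R d)%type]
    (fun z : borel (blockvec R d * blockvec R d)%type =>
       N k (submxcol z.1 k - submxcol z.2 k)).
Proof.
move=> nN; apply: (@continuous_borel_measurableR (blockvec R d * blockvec R d)%type).
move=> z; apply: (@continuous_comp _ _ _
  (fun z : blockvec R d * blockvec R d => submxcol z.1 k - submxcol z.2 k) (N k));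
  last exact: is_norm_continuous.
have csub : continuous (fun x : blockvec R d => submxcol x k).
  move=> x A /nbhs_ballP[e /= e0 eA].
  apply/nbhs_ballP; exists e => //= v [_ xv]; apply: eA; split=> // i j.
  by rewrite !mxE; exact: xv.
apply: cvgB; apply: continuous_comp; [exact: cvg_fst|exact: csub|exact: cvg_snd|exact: csub].
Qed.

(** * Finitely supported probability measures *)

Section discrete_probability.
Context (R : realType) (disp : measure_display) (T : measurableType disp).
Variables (I : finType) (w : I -> R) (x : I -> T).
Hypotheses (w_ge0 : forall i, 0 <= w i) (w_sum1 : \sum_i w i = 1).

(** [msum] adds measures indexed by natural numbers, so [I] is enumerated. The default weight and
    point belong to indices from [#|I|] on, which the sum never reaches. *)
Let w' (k : nat) : {nonneg R} :=
  if insub k is Some i then NngNum (w_ge0 (enum_val (i : 'I_#|I|))) else 0%:nng.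
Let x' (k : nat) : T :=
  if insub k is Some i then x (enum_val (i : 'I_#|I|)) else point.

Let discrete : set T -> \bar R :=
  msum (fun k => mscale (w' k) \d_(x' k)) #|I|.

HB.instance Definition _ := Measure.on discrete.

Let w'E (i : 'I_#|I|) : (w' i)%:num = w (enum_val i).
Proof. by rewrite /w' valK. Qed.

Let x'E (i : 'I_#|I|) : x' i = x (enum_val i).
Proof. by rewrite /x' valK. Qed.

Let discreteE (B : set T) : discrete B = (\sum_i (w i)%:E * \d_(x i) B)%E.
Proof.
rewrite /discrete /msum [RHS](reindex (@enum_val I I)) /=; last first.
  exact/onW_bij/enum_val_bij.
by apply: eq_bigr => i _; rewrite /mscale w'E x'E.
Qed.

Let discrete_setT : discrete setT = 1%E.
Proof.
rewrite discreteE -w_sum1 -sumEFin; apply: eq_bigr => i _.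
by rewrite diracT mule1.
Qed.

HB.instance Definition _ := Measure_isProbability.Build _ _ _ discrete discrete_setT.

Let integral_discrete (f : T -> \bar R) :
  measurable_fun setT f -> (forall t, (0 <= f t)%E) ->
  (\int[discrete]_t f t = \sum_i (w i)%:E * f (x i))%E.
Proof.
move=> mf f0; rewrite /discrete ge0_integral_measure_sum //.
rewrite [RHS](reindex (@enum_val I I)) /=; last exact/onW_bij/enum_val_bij.
apply: eq_bigr => i _; rewrite ge0_integral_mscale // w'E; congr (_ * _)%E.
by rewrite integral_dirac // diracT mul1e x'E.
Qed.

Lemma discrete_probability : exists P : probability T R,
  (forall B, P B = (\sum_i (w i)%:E * \d_(x i) B)%E) /\
  (forall f : T -> \bar R, measurable_fun setT f -> (forall t, (0 <= f t)%E) ->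
     (\int[P]_t f t = \sum_i (w i)%:E * f (x i))%E).
Proof. by exists discrete; split; [exact: discreteE|exact: integral_discrete]. Qed.

End discrete_probability.

(** * Duality *)

Lemma submxcolZ (R : realType) (n : nat) (d : 'I_n -> nat) (c : R)
    (x : blockvec R d) k : submxcol (c *: x) k = c *: submxcol x k.
Proof. by apply/matrixP => i j; rewrite !mxE. Qed.

(** Dividing the homogenized constraint by [w] turns a mass-weighted displacement into an actual
    target point. *)
Lemma perspective_polyhedron (R : realType) (p D : nat) (E : 'M[R]_(p, D)) g x y w :
  0 < w -> preceq (E *m y) (w *: (g - E *m x)) -> polyhedron E g (x + w^-1 *: y).
Proof.
move=> w0 H i; rewrite mulmxDr -scalemxAr.
have /= := H i; rewrite [leRHS]mxE [X in _ * X]mxE [X in _ + X]mxE => {}H.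
by rewrite mxE [X in _ + X]mxE -lerBrDl ler_pdivrMl.
Qed.

Lemma dot_blockvec (R : realType) (n : nat) (d : 'I_n -> nat) (u v : blockvec R d) :
  dot u v = \sum_k dot (submxcol u k) (submxcol v k).
Proof.
have dotE p (x y : 'cV[R]_p) : dot x y = (x^T *m y) 0 0.
  by rewrite mxE; apply: eq_bigr => i _; rewrite mxE.
rewrite dotE -[in LHS](submxcolK u) -[in LHS](submxcolK v) tr_mxcol mul_mxrow_mxcol summxE.
by apply: eq_bigr => k _; rewrite dotE.
Qed.

Lemma probability_setI1 (disp : measure_display) (T : measurableType disp)
    (R : realType) (P : probability T R) (A B : set T) :
  measurable A -> measurable B -> P B = 1%E -> P (A `&` B) = P A.
Proof.
move=> mA mB PB.
have -> : P A = (P (A `\` B) + P (A `&` B))%E by exact: measureDI.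
suff -> : P (A `\` B) = 0%E by rewrite add0e.
apply/eqP; rewrite eq_le measure_ge0 andbT -[leRHS]/(0%E).
have <- : P (~` B) = 0%E by rewrite probability_setC // PB subee.
apply: le_measure; rewrite ?inE; [exact: measurableD|exact: measurableC|].
by move=> x [].
Qed.

(** The type of a block depends on its index, so [u] is cast along a proof of [i = k]; uniqueness of
    such proofs makes the cast trivial at [k]. *)
Lemma single_block (R : realType) (n : nat) (d : 'I_n -> nat) k (u : 'cV[R]_(d k)) :
  exists2 y : blockvec R d, submxcol y k = u
    & forall i, i != k -> submxcol y i = 0.
Proof.
exists (\mxcol_i (match i =P k with
  | ReflectT e => eq_rect_r (fun i => 'cV[R]_(d i)) u e
  | ReflectF _ => 0 end)) => [|i ik]; rewrite mxcolK; case: eqP => //.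
  by move=> e; rewrite eq_axiomK.
by move=> e; rewrite e eqxx in ik.
Qed.

(** With [e] valued in 0 and 1 this is the projection erasing selected blocks. [tagnat.sig1] maps a
    flat coordinate to its block. *)
Lemma block_scaling (R : realType) (n : nat) (d : 'I_n -> nat) (e : 'I_n -> R) :
  exists E : 'M[R]_(\sum_k d k),
    forall (y : blockvec R d) k, submxcol (E *m y) k = e k *: submxcol y k.
Proof.
exists (diag_mx (\row_i e (tagnat.sig1 i))) => y k.
by apply/matrixP => i j; rewrite mul_diag_mx !mxE tagnat.Rank1K.
Qed.

(** * The finite-dimensional primal, weak duality and strong duality *)

Unset Implicit Arguments.

Section duality.
Context (R : realType) (n : nat) (d : 'I_n -> nat)
  (N : forall k, 'cV[R]_(d k) -> R) (N_norm : forall k, is_norm (N k))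
  (q : nat) (C : 'M[R]_(q, \sum_k d k)) (f : 'cV[R]_q)
  (m : nat) (r : 'I_m -> nat)
  (A : forall j, 'M[R]_(r j, \sum_k d k)) (b : forall j, 'cV[R]_(r j))
  (M : nat) (vartheta : 'I_M -> R) (xi : 'I_M -> blockvec R d)
  (Q : probability (borel (blockvec R d)) R) (eps : 'cV[R]_n).
Hypothesis xiC : forall l, polyhedron C f (xi l).
Hypothesis vartheta_ge0 : forall l, 0 <= vartheta l.
Hypothesis vartheta_sum1 : \sum_l vartheta l = 1.
Hypothesis QE : forall B : set (borel (blockvec R d)), measurable B ->
  Q B = (\sum_l (vartheta l)%:E * \d_(xi l : borel (blockvec R d)) B)%E.
Hypothesis m_gt0 : (0 < m)%N.

(** Atom [l] sends the fraction [w l j] of its mass to a point of [A j] displaced by [y l j / w l j]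
    and keeps the rest in place. The mass of the union is only bounded below, as mass left in place
    may lie there too. *)
Lemma transport_of_feasible (w : 'I_M -> 'I_m -> R) (y : 'I_M -> 'I_m -> blockvec R d) :
  (forall l j, 0 <= w l j) -> (forall l, \sum_j w l j <= 1) ->
  (forall l j, preceq (A j *m y l j) (w l j *: (b j - A j *m xi l))) ->
  (forall l j, preceq (C *m y l j) (w l j *: (f - C *m xi l))) ->
  (forall k, \sum_l \sum_j vartheta l * N k (submxcol (y l j) k) <= eps k 0) ->
  exists2 P, multi_transport_1 N (polyhedron C f) Q eps P
    & ((\sum_l \sum_j vartheta l * w l j)%:E
        <= P (\bigcup_j polyhedron (A j) (b j)))%E.
Proof.
move=> w0 w1 Ay Cy Ny.
pose E := borel (blockvec R d).
pose EE := borel (blockvec R d * blockvec R d)%type.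
pose I : finType := ('I_M * 'I_m + 'I_M)%type.
(* Where [w l j = 0] the inverse is [0], and the target is [xi l] itself. *)
pose target (l : 'I_M) (j : 'I_m) : E := xi l + (w l j)^-1 *: y l j.
pose W (i : I) := match i with
  | inl lj => vartheta lj.1 * w lj.1 lj.2
  | inr l => vartheta l * (1 - \sum_j w l j) end.
pose X (i : I) : EE := match i with
  | inl lj => (xi lj.1, target lj.1 lj.2)
  | inr l => (xi l, xi l) end.
have W0 i : 0 <= W i by case: i => [[l j]|l] /=; rewrite mulr_ge0 // subr_ge0.
have sumW (F : I -> \bar R) : (forall i, 0 <= F i)%E ->
  (\sum_i (W i)%:E * F i = \sum_l (\sum_j (vartheta l * w l j)%:E * F (inl (l, j))
      + (vartheta l * (1 - \sum_j w l j))%:E * F (inr l)))%E.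
  move=> F0; rewrite big_sumType /= big_split /=; congr (_ + _)%E.
  by rewrite pair_bigA; apply: eq_bigr => -[].
have W1 : \sum_i W i = 1.
  apply: EFin_inj; rewrite -sumEFin.
  transitivity (\sum_i (W i)%:E * 1)%E; first by apply: eq_bigr => i _; rewrite mule1.
  rewrite (sumW (fun=> 1%E)) //= -[in RHS]vartheta_sum1 -sumEFin; apply: eq_bigr => l _.
  under eq_bigr do rewrite mule1.
  by rewrite sumEFin mule1 -EFinD -mulr_sumr; congr EFin; ring.
have [pi [piE int_pi]] := discrete_probability X W0 W1.
(* The second marginal, built directly from the same weights at the targets. *)
have [P [PE _]] := discrete_probability (fun i => (X i).2 : E) W0 W1.
have targetC l j : polyhedron C f (target l j).
  rewrite /target; have := w0 l j; rewrite le_eqVlt => /orP[/eqP <-|wlj].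
    by rewrite invr0 scale0r addr0; exact: xiC.
  exact: perspective_polyhedron.
exists P; first exists pi; first split.
- rewrite piE -[RHS]/(1%:E) -W1 -sumEFin; apply: eq_bigr => i _.
  have Xi : (polyhedron C f `*` polyhedron C f) (X i) by case: i => [[l j]|l]; split=> /=.
  by rewrite diracE mem_set // mule1.
- move=> B mB; rewrite /pushforward piE QE // sumW //.
  apply: eq_bigr => l _.
  have dE (t : blockvec R d) :
    \d_((xi l, t) : EE) ((fst : EE -> E) @^-1` B) = \d_(xi l : E) B :> \bar R by [].
  rewrite /= dE; under eq_bigr do rewrite dE.
  rewrite -ge0_sume_distrl; last by move=> j _; rewrite lee_fin mulr_ge0.
  rewrite sumEFin -ge0_muleDl.
  - by rewrite -EFinD -mulr_sumr; congr (_%:E * _)%E; ring.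
  - by rewrite lee_fin sumr_ge0 // => j _; rewrite mulr_ge0.
  - by rewrite lee_fin mulr_ge0 // subr_ge0.
- move=> k; rewrite int_pi; last 2 first.
  + apply/measurable_EFinP; exact: measurable_norm_diff.
  + by move=> t; rewrite lee_fin is_norm_ge0.
  rewrite sumW => [|i]; last by rewrite lee_fin is_norm_ge0.
  apply: (@le_trans _ _ (\sum_l \sum_j vartheta l * N k (submxcol (y l j) k))%:E); last first.
    by rewrite lee_fin.
  rewrite -sumEFin lee_sum // => l _ /=.
  rewrite subrr (is_norm0 (N_norm k)) mule0 adde0 -sumEFin lee_sum // => j _.
  rewrite -EFinM lee_fin -mulrA ler_wpM2l //.
  rewrite /target submxcolD opprD addNKr is_normN //.
  (* A piece of mass zero costs nothing whatever [y l j] is; otherwise [w l j] cancels by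
     homogeneity of the norm. *)
  have := w0 l j; rewrite le_eqVlt => /orP[/eqP <-|wlj].
    by rewrite mul0r is_norm_ge0.
  by rewrite submxcolZ (is_normZ (N_norm k)) gtr0_norm ?invr_gt0 // mulVKf ?gt_eqF.
- by move=> B mB; rewrite /pushforward piE PE; apply: eq_bigr => i _; rewrite !diracE.
- rewrite PE sumW //.
  rewrite -sumEFin lee_sum // => l _.
  rewrite -[leLHS]adde0 leeD //; last first.
    by rewrite mule_ge0 // lee_fin // mulr_ge0 // subr_ge0.
  rewrite -sumEFin lee_sum // => j _ /=.
  have := w0 l j; rewrite le_eqVlt => /orP[/eqP w00|wlj].
    by rewrite -w00 mulr0 mul0e.
  rewrite diracE mem_set ?mule1 //; exists j => //.
  exact: perspective_polyhedron.
Qed.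

(** Almost surely the first coordinate is an atom and both coordinates lie in the support; there the
    indicator of the event is at most a function of the atom plus the weighted cost. The cost
    integrates to at most [dot lambda eps], the other term against [Q]. *)
Lemma weak_duality (P : probability (borel (blockvec R d)) R)
    (lambda : 'cV[R]_n) (s : 'I_M -> R) (gamma : 'I_M -> 'I_m -> 'cV[R]_q)
    (theta : 'I_M -> forall j, 'cV[R]_(r j)) :
  multi_transport_1 N (polyhedron C f) Q eps P ->
  (forall l j, 1 + dot (theta l j) (b j - A j *m xi l)
                 + dot (gamma l j) (f - C *m xi l) <= s l) ->
  (forall l j k, (dual_norm (N k)
      (submxcol ((A j)^T *m theta l j + C^T *m gamma l j) k) <= (lambda k 0)%:E)%E) ->
  (forall l j, preceq 0 (gamma l j) /\ preceq 0 (theta l j)) ->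
  (forall l, 0 <= s l) ->
  (P (\bigcup_j polyhedron (A j) (b j))
     <= (dot lambda eps + \sum_l vartheta l * s l)%:E)%E.
Proof.
move=> [pi [piC pi_fst pi_cost pi_snd]] Hs Hdual Hpos s0.
pose E := borel (blockvec R d).
pose EE := borel (blockvec R d * blockvec R d)%type.
(* The sign of [lambda] is read off one dual norm constraint, which needs an index [l] as well as an
   index [j]. *)
have l0 : 'I_M.
  case: (pickP (@predT 'I_M)) => [l _ //|H].
  by have := vartheta_sum1; rewrite big_pred0 // => /eqP; rewrite eq_sym oner_eq0.
have lambda0 k : 0 <= lambda k 0.
  exact: (dual_norm_le_ge0 (N_norm k) (Hdual l0 (Ordinal m_gt0) k)).
pose cost (z : EE) := \sum_k lambda k 0 * N k (submxcol z.1 k - submxcol z.2 k).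
have cost0 z : 0 <= cost z.
  by apply: sumr_ge0 => k _; rewrite mulr_ge0 ?is_norm_ge0.
(* Moving from [xi l] to [x] changes the left side of the constraint on [s l] by a pairing with
   [xi l - x], bounded by the cost; at [x] the two slack terms are nonnegative. *)
have reach l j x : polyhedron C f x -> polyhedron (A j) (b j) x ->
    1 - cost (xi l, x) <= s l.
  move=> Cx Ax; have [gamma0 theta0] := Hpos l j.
  have Hcost : dot ((A j)^T *m theta l j + C^T *m gamma l j) (xi l - x) <= cost (xi l, x).
    rewrite dot_blockvec ler_sum // => k _; rewrite submxcolB.
    exact: (dot_le_dual_norm _ (N_norm k) (Hdual l j k)).
  have tA : 0 <= dot (theta l j) (b j - A j *m x).
    by apply: dot_ge0 => // i; have := Ax i; rewrite -subr_ge0 !mxE.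
  have tC : 0 <= dot (gamma l j) (f - C *m x).
    by apply: dot_ge0 => // i; have := Cx i; rewrite -subr_ge0 !mxE.
  move: Hcost tA tC (Hs l j).
  rewrite dotDl !dot_mulmx !mulmxBr !dotBr; lra.
pose pts := undup (codom xi).
(* The atoms need not be distinct, so [s] is not a function of the atom; this
   infimum is the best bound valid at [p], and is [0] where there is no atom. *)
pose t p := inf [set s l | l in [set l | xi l = p]].
have has_l l : [set s l' | l' in [set l' | xi l' = xi l]] !=set0 by exists (s l), l.
have t_lb c p : p \in pts -> (forall l, xi l = p -> c <= s l) -> c <= t p.
  rewrite mem_undup => /codomP[l ->] Hc; apply: lb_le_inf => // _ [l' /= e <-].
  exact: Hc.
have t_le l : t (xi l) <= s l.
  apply: ge_inf; last by exists l.
  by exists 0 => _ [l' _ <-].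
have t0 p : 0 <= t p.
  have [t_ne|/set0P/negP/negPn/eqP t_e] := pselect ([set s l | l in [set l | xi l = p]] !=set0).
    by apply: lb_le_inf => // _ [l _ <-].
  by rewrite /t t_e inf0.
have m1 p : measurable [set p : E].
  apply: closed_borel_measurable; apply: accessible_closed_set1.
  exact/hausdorff_accessible/norm_hausdorff.
have mset (X : set E) : measurable X -> measurable ((fst : EE -> E) @^-1` X).
  by move=> mX; rewrite -[X in measurable X]setTI; apply: measurable_borel_fst.
have mset2 (X : set E) : measurable X -> measurable ((snd : EE -> E) @^-1` X).
  by move=> mX; rewrite -[X in measurable X]setTI; apply: measurable_borel_snd.
have mC : measurable (polyhedron C f : set E).
  by apply: (@closed_borel_measurable (blockvec R d)); exact: closed_polyhedron.
have mA : measurable (\bigcup_j polyhedron (A j) (b j) : set E).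
  apply: fin_bigcup_measurable => // j _.
  by apply: (@closed_borel_measurable (blockvec R d)); exact: closed_polyhedron.
have mCC : measurable (polyhedron C f `*` polyhedron C f : set EE).
  rewrite (_ : _ `*` _ = (fst : EE -> E) @^-1` polyhedron C f
                         `&` (snd : EE -> E) @^-1` polyhedron C f) //.
  by apply: measurableI; [exact: mset|exact: mset2].
pose atoms : set E := [set p | p \in pts].
have matoms : measurable atoms.
  rewrite (_ : atoms = \bigcup_(p in [set` pts]) [set p]); last first.
    by apply/seteqP; split=> [p pp|p [p' pp ->] //]; exists p.
  by apply: fin_bigcup_measurable => //; exact: finite_seq.
have pi_atoms : pi ((fst : EE -> E) @^-1` atoms) = 1%E.
  rewrite -[LHS]/(pushforward pi (fst : EE -> E) atoms) pi_fst // QE //.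
  rewrite -[RHS]/(1%:E) -vartheta_sum1 -sumEFin; apply: eq_bigr => l _.
  rewrite diracE mem_set ?mule1 // /atoms /= mem_undup; exact: codom_f.
rewrite -pi_snd // /pushforward.
(* The event is cut down to sets of full measure, so that the pointwise bound is needed only where
   [reach] applies; elsewhere nonnegativity of [g] suffices. *)
rewrite -(@probability_setI1 _ _ _ pi _ _ _ mCC piC); last exact: mset2.
rewrite -(@probability_setI1 _ _ _ pi _ _ _ (mset _ matoms) pi_atoms); last first.
  by apply: measurableI => //; exact: mset2.
set G := (X in pi X).
have mG : measurable G.
  by apply: measurableI; [apply: measurableI => //; exact: mset2|exact: mset].
rewrite -[X in pi X]setIT -integral_indic //.
pose g1 (p : blockvec R d) (z : EE) : \bar R := (t p * \1_((fst : EE -> E) @^-1` [set p]) z)%:E.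
pose g2 k (z : EE) : \bar R :=
  (lambda k 0 * N k (submxcol z.1 k - submxcol z.2 k))%:E.
pose g (z : EE) : \bar R := (\sum_(p <- pts) g1 p z + \sum_k g2 k z)%E.
have mg1 p : measurable_fun setT (g1 p).
  apply/measurable_EFinP; apply: measurable_funM => //.
  by apply: measurable_indic; exact: mset.
have mg2 k : measurable_fun setT (g2 k).
  apply/measurable_EFinP; apply: measurable_funM => //.
  exact: measurable_norm_diff.
have g10 p z : (0 <= g1 p z)%E by rewrite lee_fin mulr_ge0.
have g20 k z : (0 <= g2 k z)%E by rewrite lee_fin mulr_ge0 // is_norm_ge0.
apply: (@le_trans _ _ (\int[pi]_z g z)%E).
  apply: ge0_le_integral => //.
  - by apply/measurable_EFinP; exact: measurable_indic.
  - by apply: emeasurable_funD; exact: emeasurable_sum.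
  - move=> z _; rewrite /g /g1 /g2 !sumEFin -EFinD lee_fin -/(cost z).
    rewrite indicE; case: (boolP (z \in G)) => [/set_mem|_]; last first.
      by rewrite addr_ge0 // sumr_ge0 // => p _; rewrite mulr_ge0.
    case=> [[[j _ Ajz] [_ Cz]] zpts].
    (* As [pts] has no repetition, exactly one indicator is nonzero and the sum is [t z.1]. *)
    rewrite (bigD1_seq z.1) ?undup_uniq //= indicE mem_set // mulr1.
    rewrite [X in _ <= _ + X + _]big1 ?addr0 => [|p pz]; last first.
      by rewrite indicE memNset ?mulr0 // => /= e; rewrite e eqxx in pz.
    rewrite -lerBlDr; apply: t_lb => // l zl.
    by have := reach l j z.2 Cz Ajz; rewrite zl -surjective_pairing.
rewrite ge0_integralD //; last 4 first.
- by move=> z _; exact: sume_ge0.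
- exact: emeasurable_sum.
- by move=> z _; exact: sume_ge0.
- exact: emeasurable_sum.
rewrite addeC EFinD leeD //.
  rewrite ge0_integral_sum // /dot -sumEFin lee_sum // => k _.
  rewrite /g2; under eq_integral do rewrite EFinM.
  rewrite ge0_integralZl_EFin //.
  - by rewrite EFinM lee_wpmul2l // lee_fin.
  - by move=> z _; rewrite lee_fin is_norm_ge0.
  - by apply/measurable_EFinP; exact: measurable_norm_diff.
have -> : (\int[pi]_z \sum_(p <- pts) g1 p z = \sum_(p <- pts) (t p)%:E * Q [set p])%E.
  rewrite ge0_integral_sum //; apply: eq_bigr => p _.
  rewrite /g1; under eq_integral do rewrite EFinM.
  rewrite ge0_integralZl_EFin //.
  - have mp := mset _ (m1 p).
    by rewrite integral_indic // setIT -pi_fst.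
  - by apply/measurable_EFinP; apply: measurable_indic; exact: mset.
(* Coinciding atoms pool their masses; exchanging the two sums below returns to one term
   [vartheta l * t (xi l)] per index. *)
have QE' p : Q [set p] = (\sum_l vartheta l * (xi l == p)%:R)%:E.
  rewrite QE // -sumEFin; apply: eq_bigr => l _; rewrite EFinM diracE.
  rewrite (_ : (_ \in [set p]) = (xi l == p)) //.
  by apply/idP/idP => [/set_mem ->|/eqP ->]; rewrite ?mem_set.
rewrite (eq_bigr (fun p => (\sum_l t p * (vartheta l * (xi l == p)%:R))%:E)); last first.
  by move=> p _; rewrite QE' -EFinM mulr_sumr.
rewrite sumEFin lee_fin.
rewrite exchange_big ler_sum // => l _ /=.
rewrite (bigD1_seq (xi l)) ?undup_uniq ?mem_undup ?codom_f //= eqxx mulr1.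
rewrite [X in _ + X]big1 ?addr0 => [|p pl]; last by rewrite eq_sym (negbTE pl) !mulr0.
by rewrite mulrC ler_wpM2l.
Qed.

(** * Construction of dual variables *)

Lemma weighted_norm_convex (lambda : 'I_n -> R) (x y : blockvec R d) c :
  (forall k, 0 <= lambda k) -> 0 <= c -> c <= 1 ->
  \sum_k lambda k * N k (submxcol (c *: x + (1 - c) *: y) k) <=
  c * (\sum_k lambda k * N k (submxcol x k)) +
  (1 - c) * (\sum_k lambda k * N k (submxcol y k)).
Proof.
move=> l0 c0 c1; rewrite !mulr_sumr -big_split ler_sum // => k _ /=.
rewrite submxcolD !submxcolZ.
have := ler_wpM2l (l0 k) (is_norm_convex (submxcol x k) (submxcol y k) (N_norm k) c0 c1).
by lra.
Qed.

(** The constraints and the weighted norm are positively homogeneous, so the bound at [w = 1]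
    extends to the whole cone, as [conic_multipliers] requires. The rows of [A j] and [C] are
    stacked, and the multiplier is split accordingly. *)
Lemma cone_relaxation (lambda : 'I_n -> R) (E : 'M[R]_(\sum_k d k)) s l j :
  (forall k, 0 <= lambda k) ->
  (forall w y, 0 <= w -> w <= 1 ->
    preceq (A j *m (E *m y)) (w *: (b j - A j *m xi l)) ->
    preceq (C *m (E *m y)) (w *: (f - C *m xi l)) ->
    w - \sum_k lambda k * N k (submxcol (E *m y) k) <= s) ->
  exists (theta : 'cV[R]_(r j)) (gamma : 'cV[R]_q),
    [/\ preceq 0 theta, preceq 0 gamma,
     1 + dot theta (b j - A j *m xi l) + dot gamma (f - C *m xi l) <= s
     & forall y, - (\sum_k lambda k * N k (submxcol (E *m y) k)) <=
         dot ((A j)^T *m theta + C^T *m gamma) (E *m y)].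
Proof.
move=> l0 Hs.
pose P (u : blockvec R d) := \sum_k lambda k * N k (submxcol u k).
have P0 u : 0 <= P u by apply: sumr_ge0 => k _; rewrite mulr_ge0 // is_norm_ge0.
have PZ c u : 0 <= c -> P (c *: u) = c * P u.
  move=> c0; rewrite /P mulr_sumr; apply: eq_bigr => k _.
  by rewrite submxcolZ (is_normZ (N_norm k)) ger0_norm // mulrCA.
have dot_col p1 p2 (u1 v1 : 'cV[R]_p1) (u2 v2 : 'cV[R]_p2) :
    dot (col_mx u1 u2) (col_mx v1 v2) = dot u1 v1 + dot u2 v2.
  rewrite /dot big_split_ord; congr (_ + _); apply: eq_bigr => i _;
  by rewrite ?col_mxEu ?col_mxEd.
have preceq_col p1 p2 (u1 v1 : 'cV[R]_p1) (u2 v2 : 'cV[R]_p2) :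
    preceq (col_mx u1 u2) (col_mx v1 v2) -> preceq u1 v1 /\ preceq u2 v2.
  move=> H; split=> i; first by have := H (lshift _ i); rewrite !col_mxEu.
  by have := H (rshift _ i); rewrite !col_mxEd.
have [| |w y w0|mu [mu0 mus muP]] := @conic_multipliers R _ _ (col_mx (A j) C)
    (col_mx (b j - A j *m xi l) (f - C *m xi l)) E P s.
- by have := PZ 0 0 (lexx _); rewrite scale0r mul0r.
- by move=> x y c; exact: weighted_norm_convex.
- rewrite mul_col_mx scale_col_mx => /preceq_col[Ay Cy].
  have := w0; rewrite le_eqVlt => /orP[/eqP <-|wpos]; first by rewrite mul0r.
  have scale p (G : 'M[R]_(p, \sum_k d k)) h : preceq (G *m (E *m y)) (w *: h) ->
      preceq (G *m (E *m (w^-1 *: y))) (1 *: h).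
    move=> H i; have := H i; rewrite -!scalemxAr scale1r.
    by rewrite [leRHS]mxE [X in _ -> X <= _]mxE ler_pdivrMl.
  have := Hs 1 (w^-1 *: y) ler01 (lexx _) (scale _ _ _ Ay) (scale _ _ _ Cy).
  rewrite -scalemxAr -/(P _) PZ ?invr_ge0 // lerBlDl -lerBlDr => H.
  have := ler_wpM2l w0 H; rewrite mulVKf ?gt_eqF //.
exists (usubmx mu), (dsubmx mu); rewrite -[mu]vsubmxK in mu0 mus muP.
split.
- by have := preceq_col _ _ 0 (usubmx mu) 0 (dsubmx mu); rewrite col_mx0 => /(_ mu0)[].
- by have := preceq_col _ _ 0 (usubmx mu) 0 (dsubmx mu); rewrite col_mx0 => /(_ mu0)[].
- by move: mus; rewrite dot_col addrA.
- by move=> y; have := muP y; rewrite tr_col_mx mul_row_col.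
Qed.

(** Multipliers [lambda] for the norm constraints leave a Lagrangian that separates over the atoms;
    [s l] is the supremum of the piece of atom [l], and [cone_relaxation] turns this supremum into
    [theta l j] and [gamma l j] for each [j]. *)
Lemma strong_duality (p : R) :
  preceq 0 eps ->
  (forall (w : 'I_M -> 'I_m -> R) (y : 'I_M -> 'I_m -> blockvec R d),
    (forall l j, 0 <= w l j) -> (forall l, \sum_j w l j <= 1) ->
    (forall l j, preceq (A j *m y l j) (w l j *: (b j - A j *m xi l))) ->
    (forall l j, preceq (C *m y l j) (w l j *: (f - C *m xi l))) ->
    (forall k, \sum_l \sum_j vartheta l * N k (submxcol (y l j) k) <= eps k 0) ->
    \sum_l \sum_j vartheta l * w l j <= p) ->
  exists (lambda : 'cV[R]_n) (s : 'I_M -> R) (gamma : 'I_M -> 'I_m -> 'cV[R]_q)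
    (theta : 'I_M -> forall j, 'cV[R]_(r j)),
    [/\ forall l j, 1 + dot (theta l j) (b j - A j *m xi l)
                      + dot (gamma l j) (f - C *m xi l) <= s l,
        forall l j k, (dual_norm (N k)
          (submxcol ((A j)^T *m theta l j + C^T *m gamma l j) k) <= (lambda k 0)%:E)%E,
        forall l j, preceq 0 (gamma l j) /\ preceq 0 (theta l j),
        forall l, 0 <= s l
      & dot lambda eps + \sum_l vartheta l * s l <= p].
Proof.
move=> eps0 Hp.
(* Where [eps k 0 = 0] the norm constraint has no Slater point: it is replaced
   by the linear constraint that the [k]-th block vanishes, imposed by [E]. *)
have [E ES] := @block_scaling R n d (fun k => (eps k 0 != 0)%:R).
(* For an erased block the left side of the norm constraint is zero, so any positive budget makes it
   strictly feasible without restricting anything. *)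
pose eps' k := if eps k 0 == 0 then 1 else eps k 0.
have eps'_gt0 k : 0 < eps' k.
  by rewrite /eps'; case: eqVneq => // e0; rewrite lt_def e0; have := eps0 k; rewrite mxE.
pose V := 'I_M -> 'I_m -> (R^o * blockvec R d)%type.
pose K l j (w : R) (y : blockvec R d) := [/\ 0 <= w,
  preceq (A j *m (E *m y)) (w *: (b j - A j *m xi l))
  & preceq (C *m (E *m y)) (w *: (f - C *m xi l))].
have K0 l j : K l j 0 0 by split=> //; rewrite !mulmx0 scale0r => i.
have Kcvx l j w y w' y' c : 0 <= c -> c <= 1 -> K l j w y -> K l j w' y' ->
    K l j (c * w + (1 - c) * w') (c *: y + (1 - c) *: y').
  move=> c0 c1 [w0 Ay Cy] [w0' Ay' Cy'].
  have c1' : 0 <= 1 - c by lra.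
  have cvx s (G : 'M[R]_(s, \sum_k d k)) h : preceq (G *m (E *m y)) (w *: h) ->
      preceq (G *m (E *m y')) (w' *: h) ->
      preceq (G *m (E *m (c *: y + (1 - c) *: y'))) ((c * w + (1 - c) * w') *: h).
    move=> H H' i; rewrite !mulmxDr -!scalemxAr !mxE.
    have := ler_wpM2l c0 (H i); have := ler_wpM2l c1' (H' i).
    by rewrite !mxE; lra.
  by split; [rewrite addr_ge0 // mulr_ge0|exact: cvx|exact: cvx].
pose X : set V := [set x | forall l, (forall j, K l j (x l j).1 (x l j).2)
                            /\ \sum_j (x l j).1 <= 1].
pose obj (x : V) : R := \sum_l \sum_j vartheta l * (x l j).1.
pose g k (x : V) : R :=
  \sum_l \sum_j vartheta l * N k (submxcol (E *m (x l j).2) k) - eps' k.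
have [||||||lambda lambda0 Hlambda] := @lagrange_multipliers R V n X obj g 0 p.
- move=> x y c Xx Xy c0 c1 l; have [Kx x1] := Xx l; have [Ky y1] := Xy l.
  split=> [j|]; first exact: (Kcvx l j _ _ _ _ c c0 c1 (Kx j) (Ky j)).
  rewrite big_split /= -!mulr_sumr.
  have := ler_wpM2l c0 x1; have := ler_wpM2l (_ : 0 <= 1 - c) y1.
  by rewrite subr_ge0 => /(_ c1); lra.
- move=> x y c c0 c1; rewrite /obj !mulr_sumr -big_split ler_sum // => l _ /=.
  rewrite !mulr_sumr -big_split ler_sum // => j _ /=.
  by rewrite /GRing.scale /=; lra.
- move=> k x y c c0 c1; rewrite /g.
  suff : \sum_l \sum_j vartheta l * N k (submxcol (E *m ((c *: x + (1 - c) *: y) l j).2) k)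
    <= c * (\sum_l \sum_j vartheta l * N k (submxcol (E *m (x l j).2) k))
     + (1 - c) * (\sum_l \sum_j vartheta l * N k (submxcol (E *m (y l j).2) k)) by lra.
  rewrite !mulr_sumr -big_split ler_sum // => l _ /=.
  rewrite !mulr_sumr -big_split ler_sum // => j _ /=.
  rewrite mulmxDr -!scalemxAr submxcolD !submxcolZ.
  have := ler_wpM2l (vartheta_ge0 l) (is_norm_convex (submxcol (E *m (x l j).2) k)
    (submxcol (E *m (y l j).2) k) (N_norm k) c0 c1).
  by lra.
- by move=> l; split=> [j|]; [exact: K0|rewrite big1].
- move=> k; rewrite /g big1 ?sub0r ?oppr_lt0 // => l _; rewrite big1 // => j _ /=.
  by rewrite mulmx0 submxcol0 (is_norm0 (N_norm k)) mulr0.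
- move=> x Xx gx; apply: (Hp _ (fun l j => E *m (x l j).2)) => [l j|l|l j|l j|k].
  + by have [/(_ j)[]] := Xx l.
  + by have [] := Xx l.
  + by have [/(_ j)[]] := Xx l.
  + by have [/(_ j)[]] := Xx l.
  + have := gx k; rewrite /g /eps' subr_le0; case: eqVneq => // e0 _.
    rewrite e0 big1 // => l _; rewrite big1 // => j _.
    by rewrite ES e0 eqxx scale0r (is_norm0 (N_norm k)) mulr0.
pose P (u : blockvec R d) := \sum_k lambda k * N k (submxcol u k).
have P0 u : 0 <= P u by apply: sumr_ge0 => k _; rewrite mulr_ge0 // is_norm_ge0.
have P00 : P 0 = 0.
  by apply: big1 => k _; rewrite submxcol0 (is_norm0 (N_norm k)) mulr0.
(* Lagrangian values when atom [l] uses a single [j]; these suffice, since the dual constraints are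
   indexed by single pairs [(l, j)]. *)
pose val l := [set v | exists j w y, [/\ K l j w y, w <= 1 & v = w - P (E *m y)]].
have val0 l : val l 0.
  by exists (Ordinal m_gt0), 0, 0; split; rewrite ?mulmx0 ?P00 ?subr0.
have val_sup l : has_sup (val l).
  split; first by exists 0; exact: val0.
  by exists 1 => _ [j [w [y [_ w1 ->]]]]; have := P0 (E *m y); lra.
pose s l := sup (val l).
have s_ge l v : val l v -> v <= s l by move=> vv; apply: ub_le_sup => //; case: (val_sup l).
(* Each atom takes a choice within [e] of its supremum; together these form one admissible [x], and
   since the masses sum to 1 the total error is [e]. *)
have Hval : \sum_k lambda k * eps' k + \sum_l vartheta l * s l <= p.
  apply/ler_addgt0Pr => e e0.
  have /choice[jwy Hjwy] l : exists v : 'I_m * (R^o * blockvec R d),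
      [/\ K l v.1 v.2.1 v.2.2, v.2.1 <= 1 & s l - e < v.2.1 - P (E *m v.2.2)].
    have [_ [j [w [y [Kwy w1 ->]]]] H] := sup_adherent e0 (val_sup l).
    by exists (j, (w, y)).
  pose x : V := fun l j => if j == (jwy l).1 then (jwy l).2 else 0.
  have sumx l (F : R^o * blockvec R d -> R) : F 0 = 0 ->
      \sum_j F (x l j) = F (jwy l).2.
    move=> F0; rewrite (bigD1 (jwy l).1) //= /x eqxx [X in _ + X]big1 ?addr0 // => j jl.
    by rewrite (negbTE jl).
  have Xx : X x.
    move=> l; have [Kl w1 _] := Hjwy l; split=> [j|]; last by rewrite (sumx l fst).
    by rewrite /x; case: eqP => [->//|_]; exact: K0.
  have := Hlambda x Xx.
  have -> : obj x = \sum_l vartheta l * (jwy l).2.1.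
    apply: eq_bigr => l _; rewrite (sumx l (fun v => vartheta l * v.1)) //=.
    by rewrite mulr0.
  have -> : \sum_k lambda k * g k x = \sum_l vartheta l * P (E *m (jwy l).2.2)
      - \sum_k lambda k * eps' k.
    transitivity (\sum_k (\sum_l vartheta l * (lambda k * N k (submxcol (E *m (jwy l).2.2) k))
        - lambda k * eps' k)).
      apply: eq_bigr => k _; rewrite /g mulrBr mulr_sumr; congr (_ - _).
      apply: eq_bigr => l _.
      have -> : \sum_j vartheta l * N k (submxcol (E *m (x l j).2) k)
          = vartheta l * N k (submxcol (E *m (jwy l).2.2) k); last exact: mulrCA.
        apply: (sumx l (fun v => vartheta l * N k (submxcol (E *m v.2) k))).
        by rewrite mulmx0 submxcol0 (is_norm0 (N_norm k)) mulr0.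
    rewrite sumrB; congr (_ - _); rewrite exchange_big; apply: eq_bigr => l _.
    by rewrite mulr_sumr.
  have : \sum_l vartheta l * (s l - e) <=
      \sum_l vartheta l * ((jwy l).2.1 - P (E *m (jwy l).2.2)).
    by apply: ler_sum => l _; rewrite ler_wpM2l //; have [_ _ /ltW] := Hjwy l.
  rewrite (eq_bigr (fun l => vartheta l * s l - vartheta l * e)) => [|l _]; last exact: mulrBr.
  rewrite [X in _ <= X -> _](eq_bigr (fun l => vartheta l * (jwy l).2.1
    - vartheta l * P (E *m (jwy l).2.2))) => [|l _]; last exact: mulrBr.
  rewrite !sumrB -[X in _ - X <= _]mulr_suml vartheta_sum1 mul1r; lra.
have Hmult l j := cone_relaxation lambda E (s l) l j lambda0
  (fun w y w0 w1 Ay Cy => s_ge l _ (ex_intro _ j (ex_intro _ w (ex_intro _ y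
     (And3 (And3 w0 Ay Cy) w1 erefl))))).
pose theta l j := sval (cid (Hmult l j)).
have Hgamma l j := svalP (cid (Hmult l j)).
pose gamma l j := sval (cid (Hgamma l j)).
have Hmu l j : [/\ preceq 0 (theta l j), preceq 0 (gamma l j),
    1 + dot (theta l j) (b j - A j *m xi l) + dot (gamma l j) (f - C *m xi l) <= s l
    & forall y, - P (E *m y) <=
        dot ((A j)^T *m theta l j + C^T *m gamma l j) (E *m y)].
  exact: svalP (cid (Hgamma l j)).
pose z l j := (A j)^T *m theta l j + C^T *m gamma l j.
have HL l j k : exists L, 0 <= L /\ forall u, dot (submxcol (z l j) k) u <= L * N k u.
  by have [L L0 HL] := dot_le_is_norm (submxcol (z l j) k) (N_norm k); exists L.
have [L [L_ge0 LP]] : exists L : 'I_M -> 'I_m -> 'I_n -> R, (forall l j k, 0 <= L l j k) /\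
    forall l j k u, dot (submxcol (z l j) k) u <= L l j k * N k u.
  exists (fun l j k => sval (cid (HL l j k))).
  by split=> l j k; have [] := svalP (cid (HL l j k)).
have L_le l j k : L l j k <= \sum_l \sum_j L l j k.
  rewrite (bigD1 l) //= (bigD1 j) //= -addrA lerDl.
  by rewrite addr_ge0 ?sumr_ge0 // => ? _; rewrite sumr_ge0.
(* Where [eps k 0 = 0] the multiplier costs nothing in the objective, so it is replaced by a bound
   valid for all pairs [(l, j)]; a sum of the nonnegative [L] is such a bound. *)
pose lam := \col_k (if eps k 0 == 0 then \sum_l \sum_j L l j k else lambda k).
exists lam, s, gamma, theta; split.
- by move=> l j; have [] := Hmu l j.
- move=> l j k; rewrite mxE; case: eqVneq => [e0|e0].
    apply: dual_norm_le => [|u]; first by apply: sumr_ge0 => ? _; exact: sumr_ge0.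
    by rewrite (le_trans (LP l j k u)) // ler_wpM2r ?is_norm_ge0.
  apply: dual_norm_le => // u.
  (* Testing the minorant on a vector with the single block [- u] isolates the dual norm inequality
     of block [k]. *)
  have [y yk yi] := single_block (- u).
  have [_ _ _ /(_ y)] := Hmu l j.
  have -> : P (E *m y) = lambda k * N k u.
    rewrite /P (bigD1 k) //= [X in _ + X]big1 => [|i ik].
      by rewrite ES e0 scale1r yk is_normN // addr0.
    by rewrite ES yi // scaler0 (is_norm0 (N_norm i)) mulr0.
  rewrite -/(z l j) dot_blockvec (bigD1 k) //= [X in _ + X]big1 => [|i ik].
    by rewrite ES e0 scale1r yk dotNr addr0 lerN2.
  by rewrite ES yi // scaler0 dot0r.
- by move=> l j; have [] := Hmu l j.
- by move=> l; apply: s_ge; exact: val0.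
(* On an erased block the left term is zero and the right one is [lambda k], which is
   nonnegative. *)
- rewrite (le_trans _ Hval) // lerD2r ler_sum // => k _.
  rewrite mxE /eps'; case: eqVneq => [->|//].
  by rewrite mulr0 mulr1.
Qed.

End duality.

(** * Equality of the two optimal values *)

Theorem theorem6p1 (R : realType) (n : nat) (d : 'I_n -> nat)
  (N : forall k, 'cV[R]_(d k) -> R)
  (N_norm : forall k, is_norm (N k))
  (q : nat) (C : 'M[R]_(q, \sum_k d k)) (f : 'cV[R]_q)
  (m : nat) (m_gt0 : (0 < m)%N) (r : 'I_m -> nat)
  (A : forall j, 'M[R]_(r j, \sum_k d k)) (b : forall j, 'cV[R]_(r j))
  (M : nat) (vartheta : 'I_M -> R) (xi : 'I_M -> blockvec R d)
  (Q : probability (borel (blockvec R d)) R) (eps : 'cV[R]_n) :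
  polyhedron C f !=set0 ->
  (forall j, (polyhedron (A j) (b j) `&` polyhedron C f) !=set0) ->
  (forall l, polyhedron C f (xi l)) ->
  (forall l, 0 <= vartheta l) ->
  \sum_l vartheta l = 1 ->
  (forall B : set (borel (blockvec R d)), measurable B ->
     Q B = (\sum_l (vartheta l)%:E * \d_(xi l : borel (blockvec R d)) B)%E) ->
  preceq 0 eps ->
  ereal_sup [set P (\bigcup_j polyhedron (A j) (b j))
            | P in multi_transport_1 N (polyhedron C f) Q eps] =
  ereal_inf [set v : \bar R |
    exists (lambda : 'cV[R]_n) (s : 'I_M -> R)
      (gamma : 'I_M -> 'I_m -> 'cV[R]_q)
      (theta : 'I_M -> forall j, 'cV[R]_(r j)),
    [/\ forall l j, 1 + dot (theta l j) (b j - A j *m xi l)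
                      + dot (gamma l j) (f - C *m xi l) <= s l,
        forall l j k,
          (dual_norm (N k)
             (submxcol ((A j)^T *m theta l j + C^T *m gamma l j) k)
             <= (lambda k 0)%:E)%E,
        forall l j, preceq 0 (gamma l j) /\ preceq 0 (theta l j),
        forall l, 0 <= s l
      & v = (dot lambda eps + \sum_l vartheta l * s l)%:E] ].
Proof.
move=> _ _ xiC vartheta_ge0 vartheta_sum1 QE eps0.
apply/eqP; rewrite eq_le; apply/andP; split.
  apply: ge_ereal_sup => _ [P TP <-].
  apply: le_ereal_inf_tmp => _ [lambda [s [gamma [theta [Hs Hdual Hpos s0 ->]]]]].
  exact: (weak_duality R n d N N_norm q C f m r A b M vartheta xi Q eps
    vartheta_ge0 vartheta_sum1 QE m_gt0 P lambda s gamma theta).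
have feasible := transport_of_feasible R n d N N_norm q C f m r A b M vartheta xi
  Q eps xiC vartheta_ge0 vartheta_sum1 QE.
case supE : (ereal_sup _) => [p| |]; last 2 first.
- exact: leey.
(* The value [-oo] is excluded by the coupling that leaves every atom in place, which is admissible
   because [eps] is nonnegative. *)
- have [||l j i|l j i|k|P TP] := feasible (fun _ _ => 0) (fun _ _ => 0).
  + by [].
  + by move=> l; rewrite big1.
  + by rewrite mulmx0 scale0r.
  + by rewrite mulmx0 scale0r.
  + rewrite big1 => [|l _]; first by have := eps0 k; rewrite mxE.
    by rewrite big1 // => j _; rewrite submxcol0 (is_norm0 (N_norm k)) mulr0.
  have : (P (\bigcup_j polyhedron (A j) (b j)) <= -oo)%E.
    by rewrite -supE; apply: ereal_sup_ubound; exists P.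
  by move=> /(le_trans (measure_ge0 P _)).
(* The finite supremum [p] bounds the finite-dimensional primal, since each of its feasible points
   is realized by a transport plan. *)
have [||lambda [s [gamma [theta [Hs Hdual Hpos s0 Hp]]]]] :=
    strong_duality R n d N N_norm q C f m r A b M vartheta xi eps
      vartheta_ge0 vartheta_sum1 m_gt0 p => //.
  move=> w y w0 w1 Ay Cy Ny; have [P TP wP] := feasible w y w0 w1 Ay Cy Ny.
  rewrite -lee_fin (le_trans wP) // -supE.
  by apply: ereal_sup_ubound; exists P.
apply: (@le_trans _ _ (dot lambda eps + \sum_l vartheta l * s l)%:E); last by rewrite lee_fin.
by apply: ereal_inf_lbound; exists lambda, s, gamma, theta.
Qed.
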